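(* Let $p$ be a real polynomial with $Z_{\mathbb{C}}(p)=2m$, and let $$2m_{\sigma^{*}}=\min_{\sigma\in\mathbb{R}} Z_{\mathbb{C}}(p_\sigma),$$ where $p_\sigma(z)=p'(z)+\sigma p(z)$. Then $$Z_{\mathbb{R}}(Q[p])\geqslant 2m-2m_{\sigma^{*}}.$$
   Context: A real polynomial is a polynomial with real coefficients. For a polynomial $p$, $Q[p]$ denotes the rational function $$Q[p](z)=\frac{d}{dz}\left(\frac{p'(z)}{p(z)}\right)=\frac{p(z)p''(z)-(p'(z))^2}{(p(z))^2}.$$ For a function $f$, $Z_{\mathbb{R}}(f)$ and $Z_{\mathbb{C}}(f)$ denote, respectively, the number of real zeroes and the number of non-real zeroes of $f$, counted with multiplicities. *)

(* Defs.v *)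
From HB Require Import structures.
From mathcomp Require Import all_boot all_order all_algebra.
From mathcomp Require Import all_classical all_reals ereal esum.
From mathcomp Require Import complex.
From mathcomp Require Import ring.

Set Implicit Arguments.
Unset Strict Implicit.
Unset Printing Implicit Defensive.

Import Order.TTheory GRing.Theory Num.Theory.
Local Open Scope ring_scope.

(* FracField.tofrac : {poly F} -> {fraction {poly F}}; the library notation is
   local to fraction.v. *)
Notation "x %:F" := (@FracField.tofrac _ x) (at level 1, format "x %:F").

Section RationalFunctions.
Variable F : fieldType.
Implicit Types (f : {fraction {poly F}}) (n d : {poly F}) (z : F).

Definition rnum f : {poly F} := \n_(repr f).
Definition rden f : {poly F} := \d_(repr f).

(* d/dz on rational functions, by the quotient rule on a representative;
   ratderivE shows independence of the representative. *)
Definition ratderiv f : {fraction {poly F}} :=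
  ((rnum f)^`() * rden f - rnum f * (rden f)^`())%:F / (rden f ^+ 2)%:F.

Definition Q (p : {poly F}) : {fraction {poly F}} := ratderiv (p^`()%:F / p%:F).

Lemma rden_neq0 f : rden f != 0.
Proof. exact: denom_ratioP. Qed.

Lemma rnumden f : f = (rnum f)%:F / (rden f)%:F.
Proof.
apply: (canRL (mulfK _)); first by rewrite tofrac_eq0 rden_neq0.
rewrite -{1}[f]reprK; have := rden_neq0 f; rewrite /rnum /rden.
move: (repr f) => r r0; unlock FracField.tofrac.
rewrite -[LHS]FracField.pi_mul; apply/eqmodP.
rewrite /= FracField.equivfE /FracField.mulf /=.
by rewrite !numden_Ratio ?mulr1 ?oner_neq0// mulrC.
Qed.

Lemma rnumden_cross n d : d != 0 ->
  n * rden (n%:F / d%:F) = rnum (n%:F / d%:F) * d.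
Proof.
move=> d0; apply/eqP; rewrite -tofrac_eq !tofracM; apply/eqP.
have /(congr1 (fun x => x * (rden (n%:F / d%:F))%:F)) := rnumden (n%:F / d%:F).
rewrite mulfVK ?tofrac_eq0 ?rden_neq0// => <-.
by rewrite mulrAC mulfVK// tofrac_eq0.
Qed.

Lemma ratderivE n d : d != 0 ->
  ratderiv (n%:F / d%:F) = (n^`() * d - n * d^`())%:F / (d ^+ 2)%:F.
Proof.
move=> d0; have E := rnumden_cross n d0; have b0 := rden_neq0 (n%:F / d%:F).
have dE := congr1 (@deriv F) E; move: dE E b0; rewrite /ratderiv !derivM.
move: (rnum _) (rden _) => a b dE E b0.
apply/eqP; rewrite eqr_div ?tofrac_eq0 ?expf_neq0//.
rewrite -!tofracM tofrac_eq; apply/eqP.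
apply: (mulfI b0); apply: (mulfI d0).
move: dE E; move: a^`() b^`() n^`() d^`() => a' b' n' d' dE E.
have -> : d * (b * ((a' * b - a * b') * d ^+ 2)) =
   d ^+ 2 * (b ^+ 2 * (a' * d) - b * b' * (a * d)) by ring.
have -> : a' * d = n' * b + n * b' - a * d' by rewrite dE; ring.
rewrite -E.
have -> : d ^+ 2 * (b ^+ 2 * (n' * b + n * b' - a * d') - b * b' * (n * b)) =
   d ^+ 2 * b ^+ 2 * (n' * b) - d * b ^+ 2 * d' * (a * d) by ring.
by rewrite -E; ring.
Qed.

Lemma QE (p : {poly F}) : p != 0 ->
  Q p = (p * p^`()^`() - p^`() ^+ 2)%:F / (p ^+ 2)%:F.
Proof. by move=> p0; rewrite /Q ratderivE// [_^`() * p]mulrC expr2. Qed.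

End RationalFunctions.

Section CountingZeros.
Variable R : realType.
Implicit Types (f : {fraction {poly R[i]}}) (z : R[i]) (p : {poly R[i]}).

(* Multiplicity of z as a zero of f: +oo for f = 0, and otherwise the order of
   f at z if it is positive, 0 if it is not.  The subtraction is the truncated
   one of nat, so that poles count as 0; zmultE shows independence of the
   representative (which need not be in lowest terms). *)
Definition zmult f z : \bar R :=
  if f == 0 then +oo%E else ((mup z (rnum f) - mup z (rden f))%N%:R)%:E.

Lemma zmultE (n d : {poly R[i]}) z : n != 0 -> d != 0 ->
  zmult (n%:F / d%:F) z = ((mup z n - mup z d)%N%:R)%:E.
Proof.
move=> n0 d0; rewrite /zmult mulf_eq0 invr_eq0 !tofrac_eq0 (negPf n0) (negPf d0).
have E := rnumden_cross n d0; have b0 := rden_neq0 (n%:F / d%:F).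
have a0 : rnum (n%:F / d%:F) != 0.
  by apply: contra_neq (mulf_neq0 n0 b0); rewrite E => ->; rewrite mul0r.
have /= := congr1 (mup z) E; rewrite !mupM// => Em.
congr (_%:R%:E); rewrite -(subnDr (mup z d)) -Em.
by rewrite [X in (_ - X)%N]addnC subnDr.
Qed.

Definition ZR f : \bar R := (\esum_(z in [set z | z \is Num.real]) zmult f z)%E.

Definition ZC f : \bar R :=
  (\esum_(z in [set z | z \isn't Num.real]) zmult f z)%E.

Definition real_poly p : bool := p \is a polyOver Num.real.

Definition psigma p (sigma : R) : {poly R[i]} :=
  p^`() + (real_complex R sigma) *: p.

End CountingZeros.

Definition is_min d (T : porderType d) (A : set T) (x : T) : Prop :=
  A x /\ lbound A x.

(* Main.v *)
Require Import Defs.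
From mathcomp Require Import all_boot all_order all_algebra.
From mathcomp Require Import all_classical all_reals ereal esum.
From mathcomp Require Import complex.
From mathcomp Require Import polyorder polyrcf topology normedtype derive.
From mathcomp Require Import ring lra zify.

(** The inequality holds for every real shift [s], not only for a minimising
    one.  Let [P] be a real polynomial of degree [n >= 1], [q = P' + s P],
    [phi = q / P], and [W = P P'' - P'^2 = q' P - q P'].  Then [phi'] is
    [W / P^2], which is also [Q[P]], and the real zeros of [Q[P]] are the real
    zeros of [W] that are not zeros of [P] (at a zero of [P], [Q[P]] has a
    double pole).

    The core is a Rolle argument on the circle formed by the real line and the
    point at infinity.  Between two consecutive real zeros of [q] that are not
    zeros of [P], either [P] vanishes, or [phi] is regular and [W] vanishes
    ([rolle_dshift]).  The gap through infinity obeys the same rule: if neither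
    [P] nor [W] vanishes on the half-line to the right of the last of these
    zeros, then [W < 0] there, because the leading coefficient of [W] is negative
    ([logwronsk_lead]), so [phi] decreases from 0 and is negative, whereas its
    sign near infinity is the sign of [s], or positive when [s = 0]
    ([gap_right]); the situation on the left is symmetric ([gap_left]).  The
    two half-lines cannot both be free of zeros of [P W] when [s <> 0], and
    neither of them can when [s = 0]: then infinity itself is a zero of [phi]
    and splits the gap in two.  Hence, counting distinct points, the zeros of
    [q] off those of [P], plus one if [s = 0], are at most as many as the zeros
    of [P] plus the zeros of [W] off those of [P q] ([count_gaps]).

    Multiplicities are added afterwards ([sum_mup_dshift]): a zero of [q] of
    multiplicity [k] off [P] is a zero of [W] of multiplicity at least [k - 1],
    and a zero of [P] of multiplicity [k] is a zero of [q] of multiplicity less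
    than [k].  Finally, the number of non-real zeros of a real polynomial is its
    degree minus the number of its real zeros ([ZC_real_poly]); the degree of
    [q] is [n], or [n - 1] if [s = 0], which accounts for the extra gap. *)

Set Implicit Arguments.
Unset Strict Implicit.
Unset Printing Implicit Defensive.

Import numFieldNormedType.Exports.
Import Order.TTheory GRing.Theory Num.Theory.
Local Open Scope ring_scope.

(** * The polynomials P' + s P and P P'' - P'^2 *)

(** The numerator of [(P' / P)' = logwronsk P / P^2]. *)
Definition logwronsk (K : fieldType) (P : {poly K}) : {poly K} :=
  P * P^`()^`() - P^`() ^+ 2.

(** The polynomial [P' + s P], over any field; [map_dshift] below identifies it
    with [psigma] on real polynomials. *)
Definition dshift (K : fieldType) (P : {poly K}) (s : K) : {poly K} :=
  P^`() + s *: P.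

(** The shift by [s] adds a constant to [P' / P], hence does not change its
    derivative. *)
Lemma wronsk_dshift (K : fieldType) (P : {poly K}) s :
  (dshift P s)^`() * P - dshift P s * P^`() = logwronsk P.
Proof. by rewrite /dshift /logwronsk derivD derivZ -!mul_polyC; ring. Qed.

Lemma coefM_top (K : nzRingType) (f g : {poly K}) a b :
  (size f <= a.+1)%N -> (size g <= b.+1)%N -> (f * g)`_(a + b) = f`_a * g`_b.
Proof.
move=> sf sg; rewrite coefM.
have ha : (a < (a + b).+1)%N by rewrite ltnS leq_addr.
rewrite (bigD1 (Ordinal ha)) //= addKn big1 ?addr0 // => i /eqP ia.
have [lt_ai|le_ia] := ltnP a i.
  by rewrite (nth_default _ (leq_trans sf lt_ai)) mul0r.
rewrite [g`_ _](nth_default) ?mulr0 //; apply: leq_trans sg _.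
have : nat_of_ord i <> a by move=> E; apply: ia; apply: val_inj.
by move: le_ia; lia.
Qed.

Section RealPoly.
Variable R : realFieldType.
Implicit Types (P f : {poly R}) (s x : R).

Lemma logwronsk_lead P : (1 < size P)%N ->
  size (logwronsk P) = (size P).-1.*2.-1 /\
  lead_coef (logwronsk P) = - (lead_coef P ^+ 2 *+ (size P).-1).
Proof.
case E : (size P) => [|[|n]] // _ /=.
have lcE : lead_coef P = P`_n.+1 by rewrite lead_coefE E.
have lc0 : P`_n.+1 != 0 by rewrite -lcE lead_coef_eq0 -size_poly_eq0 E.
(* Multiplied by X^2, both terms of W become products of two polynomials of
   size at most n.+2, whatever the degree of P. *)
have e : 'X^2 * logwronsk P = P * ('X^2 * P^`()^`()) - ('X * P^`()) ^+ 2.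
  by rewrite /logwronsk; ring.
have s1 : (size (P^`())%R <= n.+1)%N by rewrite size_deriv E.
have s2 : (size (P^`()^`())%R <= n)%N by rewrite !size_deriv E.
have t1 : (size ('X * P^`())%R <= n.+2)%N.
  by rewrite (leq_trans (size_polyMleq _ _)) // size_polyX; lia.
have t2 : (size ('X^2 * P^`()^`())%R <= n.+2)%N.
  by rewrite (leq_trans (size_polyMleq _ _)) // size_polyXn; lia.
have c2 : ('X^2 * P^`()^`())`_n.+1 = P`_n.+1 *+ (n.+1 * n).
  rewrite coefXnM; case: n {E lcE lc0 s1 s2 t1 t2} => [|n] //=.
  by rewrite !coef_deriv subSS subn1 -mulrnA mulnC.
have c1 : ('X * P^`())`_n.+1 = P`_n.+1 *+ n.+1 by rewrite coefXM coef_deriv.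
have cW : (logwronsk P)`_n.*2 = - (P`_n.+1 ^+ 2 *+ n.+1).
  have -> : (logwronsk P)`_n.*2 = ('X^2 * logwronsk P)`_(n.+1 + n.+1).
    have nn : (n.+1 + n.+1 = n.*2 + 2)%N by rewrite -addnn; lia.
    by rewrite coefXnM nn addnK ltnNge leq_addl.
  rewrite e coefB expr2 coefM_top ?E // coefM_top // c1 c2.
  rewrite -!(mulr_natr (P`_ _)) natrM -natr1; set a := P`_ _.
  by rewrite -mulr_natr -?natr1; ring.
have cW0 : (logwronsk P)`_n.*2 != 0.
  by rewrite cW oppr_eq0 mulrn_eq0 expf_eq0.
have sW : size (logwronsk P) = n.*2.+1.
  apply/eqP; rewrite eqn_leq; apply/andP; split; last first.
    by rewrite ltnNge; apply: contra cW0 => h; rewrite nth_default.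
  rewrite (leq_trans (size_polyD _ _)) // geq_max size_polyN.
  have d2 : n.*2.+1 = (n.+1 + n)%N by rewrite -addnn.
  apply/andP; split; apply: leq_trans (size_polyMleq _ _) _; rewrite d2.
    by rewrite E addSn leq_add2l.
  apply: leq_trans (_ : (n.+1 + n.+1).-1 <= _)%N; last by rewrite addnS.
  by rewrite -!subn1 leq_sub2r // leq_add.
by rewrite lead_coefE sW /= cW lcE.
Qed.

Lemma logwronsk_neq0 P : (1 < size P)%N -> logwronsk P != 0.
Proof.
by move=> h; rewrite -size_poly_eq0; have [-> _] := logwronsk_lead h; lia.
Qed.

Lemma lead_coef_deriv f : (1 < size f)%N ->
  lead_coef f^`() = lead_coef f *+ (size f).-1.
Proof.
move=> f1; rewrite !lead_coefE size_deriv coef_deriv.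
by case: (size f) f1 => [|[|n]].
Qed.

Lemma lead_coef_dshift P s : (1 < size P)%N ->
  lead_coef (dshift P s) =
    if s == 0 then lead_coef P *+ (size P).-1 else s * lead_coef P.
Proof.
move=> P1; rewrite /dshift; case: eqP => [->|/eqP s0].
  by rewrite scale0r addr0 lead_coef_deriv.
rewrite lead_coefDr ?lead_coefZ // size_deriv size_scale //.
by case: (size P) P1.
Qed.

Lemma size_dshift P s : (1 < size P)%N ->
  size (dshift P s) = (size P - (s == 0%R))%N.
Proof.
move=> P1; rewrite /dshift; case: eqP => [->|/eqP s0].
  by rewrite scale0r addr0 size_deriv subn1.
have h : (size (P^`())%R < size (s *: P)%R)%N.
  by rewrite size_scale // size_deriv; case: (size P) P1.
by rewrite addrC size_polyDl // size_scale // subn0.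
Qed.

Lemma dshift_neq0 P s : (1 < size P)%N -> dshift P s != 0.
Proof. by move=> P1; rewrite -size_poly_eq0 size_dshift //; case: eqP; lia. Qed.

Lemma deriv_neq0 P : (1 < size P)%N -> P^`() != 0.
Proof. by rewrite -size_poly_eq0 size_deriv; case: (size P) => [|[]]. Qed.

Lemma mup_multiplicity x f : f != 0 -> mup x f = multiplicity x f.
Proof.
move=> f0; apply/eqP; rewrite eqn_leq -root_le_mu // -mup_geq // leqnn /=.
by rewrite mup_geq // root_mu.
Qed.

Lemma mup_gt0 x f : f != 0 -> (0 < mup x f)%N = root f x.
Proof. by move=> f0; rewrite -XsubC_dvd // dvdp_XsubCl. Qed.

Lemma mup_deriv_root x P : (1 < size P)%N -> root P x ->
  mup x P = (mup x P^`()).+1.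
Proof.
move=> P1 Px.
have P0 : P != 0 by rewrite -size_poly_eq0; lia.
have dP0 : P^`() != 0 by apply: deriv_neq0.
by rewrite !mup_multiplicity // mu_deriv_root // addn1.
Qed.

Lemma mup_dshift_root x P s : (1 < size P)%N -> root P x ->
  (mup x (dshift P s) < mup x P)%N.
Proof.
move=> P1 Px; rewrite ltnNge; apply/negP.
have dP0 : P^`() != 0 by apply: deriv_neq0.
have P0 : P != 0 by rewrite -size_poly_eq0; lia.
rewrite mup_geq ?dshift_neq0 // /dshift dvdp_addl; last first.
  by rewrite -mul_polyC dvdp_mull // -mup_geq.
by rewrite -mup_geq // mup_deriv_root // ltnn.
Qed.

Lemma mup_logwronsk x P s : (1 < size P)%N ->
  ((mup x (dshift P s)).-1 <= mup x (logwronsk P))%N.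
Proof.
move=> P1; have q0 := dshift_neq0 s P1; set k := mup _ _.
rewrite mup_geq ?logwronsk_neq0 // -(wronsk_dshift P s).
have /dvdpP[g gE] : ('X - x%:P) ^+ k %| dshift P s by rewrite -mup_geq.
rewrite gE; case: (k) => [|j] /=; first by rewrite expr0 dvd1p.
apply/dvdpP.
(* If q = g (X - x)^(j+1), this is the cofactor of (X - x)^j in
   q' P - q P'. *)
exists ((g^`() * ('X - x%:P) + g *+ j.+1) * P - g * ('X - x%:P) * P^`()).
rewrite derivM deriv_exp derivXsubC mul1r exprS /=; ring.
Qed.

End RealPoly.

(** * Gaps between the zeros of P' + s P *)

(** The mean value theorem for the rational function [f / g]. *)
Lemma mvt_ratio (R : realType) (f g : {poly R}) (a b : R) :
  a < b -> (forall x, a <= x <= b -> ~~ root g x) ->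
  exists2 c, a < c < b & f.[b] / g.[b] - f.[a] / g.[a] =
     (f^`() * g - f * g^`()).[c] / g.[c] ^+ 2 * (b - a).
Proof.
move=> ab g0.
pose h := fun x : R => f.[x] / g.[x].
have dh x : a <= x <= b ->
    is_derive x 1 h ((f^`() * g - f * g^`()).[x] / g.[x] ^+ 2).
  move=> /g0 gx; have gx0 : g.[x] != 0 by [].
  have df := is_derive_poly f x; have dg := is_derive_poly g x.
  have [dgx dgE] := dg.
  have dV := DeriveDef (@derivableV _ _ _ _ _ gx0 dgx) (deriveV gx0 dgx).
  have D := is_deriveM df dV; rewrite dgE in D.
  refine (@is_derive_eq _ _ _ _ _ _ _ _ D _).
  rewrite !hornerE /GRing.scale /=; field; exact: gx0.
have [c cab E] : exists2 c, c \in `]a, b[ & h b - h a =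
    (f^`() * g - f * g^`()).[c] / g.[c] ^+ 2 * (b - a).
  apply: (@MVT R h (fun x => (f^`() * g - f * g^`()).[x] / g.[x] ^+ 2)) => //.
    by move=> x /andP[ax xb]; apply: dh; rewrite !ltW.
  apply: derivable_within_continuous => x; rewrite in_itv /= => xab.
  by have [] := dh x xab.
by exists c.
Qed.

Section Gaps.
Variables (R : realType) (P : {poly R}) (s : R).
Hypothesis P1 : (1 < size P)%N.
Let q := dshift P s.
Let W := logwronsk P.

Lemma lead_coef_logwronsk_lt0 : lead_coef W < 0.
Proof.
have [_ ->] := logwronsk_lead P1.
rewrite oppr_lt0 pmulrn_lgt0; last by case: (size P) P1 => [|[]].
rewrite exprn_even_gt0 //= lead_coef_eq0 -size_poly_eq0.
by case: (size P) P1.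
Qed.

Lemma logwronsk_lt0_right x : (forall y, x < y -> ~~ root W y) ->
  forall y, x < y -> W.[y] < 0.
Proof.
move=> nW y xy; rewrite -sgr_lt0 (@sgp_pinftyP _ y W) ?in_itv /= ?lexx //.
  by rewrite /sgp_pinfty sgr_lt0 lead_coef_logwronsk_lt0.
by move=> z; rewrite in_itv /= andbT => yz; exact/nW/lt_le_trans/yz.
Qed.

Lemma logwronsk_lt0_left x : (forall y, y < x -> ~~ root W y) ->
  forall y, y < x -> W.[y] < 0.
Proof.
move=> nW y xy; rewrite -sgr_lt0 (@sgp_minftyP _ y W) ?in_itv /= ?lexx //.
  rewrite /sgp_minfty sgr_lt0; have [-> _] := logwronsk_lead P1.
  have -> : ((size P).-1.*2.-1.-1 = (size P).-2.*2)%N.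
    by case: (size P) P1 => [|[|n]].
  by rewrite -signr_odd odd_double expr0 mul1r lead_coef_logwronsk_lt0.
by move=> z; rewrite in_itv /= => yz; apply/nW/le_lt_trans/xy.
Qed.

Lemma mvt_dshift x y : x < y -> (forall z, x <= z <= y -> ~~ root P z) ->
  exists2 c, x < c < y &
    q.[y] / P.[y] - q.[x] / P.[x] = W.[c] / P.[c] ^+ 2 * (y - x).
Proof. by move=> xy nP; rewrite /W -(wronsk_dshift P s); apply: mvt_ratio. Qed.

(** Rolle's theorem for [q / P]. *)
Lemma rolle_dshift x y : x < y -> root q x -> root q y ->
  (forall z, x <= z <= y -> ~~ root P z) ->
  exists2 c, x < c < y & root W c.
Proof.
move=> xy /rootP qx /rootP qy nP; have [c cxy] := mvt_dshift xy nP.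
rewrite qx qy !mul0r subr0 => /esym/eqP; rewrite !mulf_eq0 invr_eq0 expf_eq0 /=.
rewrite subr_eq0 (gt_eqF xy) orbF => /orP[Wc|Pc]; first by exists c.
by have := nP c; rewrite rootE Pc => /(_ _)/negP; case=> //;
  case/andP: cxy => /ltW-> /ltW->.
Qed.

(** [q / P] is strictly decreasing where [W] is negative. *)
Lemma dshift_decr x y : x < y -> (forall z, x <= z <= y -> ~~ root P z) ->
  (forall z, x < z < y -> W.[z] < 0) -> q.[y] / P.[y] < q.[x] / P.[x].
Proof.
move=> xy nP Wlt0; have [c cxy E] := mvt_dshift xy nP.
rewrite -subr_lt0 E pmulr_llt0 ?subr_gt0 // pmulr_llt0 ?Wlt0 //.
have Pc : P.[c] != 0 by apply: nP; case/andP: cxy => /ltW-> /ltW->.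
by rewrite invr_gt0 exprn_even_gt0.
Qed.

(** If the half-line to the right of a zero of [q] contains no zero of [P W],
    then [q P] is negative on it, hence so is its leading coefficient. *)
Lemma gap_right x : root q x -> ~~ root P x ->
  (forall y, x < y -> ~~ root P y && ~~ root W y) ->
  lead_coef q * lead_coef P < 0.
Proof.
move=> /rootP qx Px no.
have nP z : x <= z -> ~~ root P z.
  by rewrite le_eqVlt => /predU1P[<-//|/no/andP[]].
have qP_lt0 y : x < y -> (q * P).[y] < 0.
  move=> xy; have Py : P.[y] != 0 by apply/nP/ltW.
  have := @dshift_decr x y xy; rewrite qx mul0r => /(_ _ _)/wrap[].
  - by move=> z /andP[/nP].
  - move=> z /andP[xz _]; apply: (logwronsk_lt0_right (x := x)) => // t /no.
    by case/andP.
  have -> : (q * P).[y] = q.[y] / P.[y] * P.[y] ^+ 2 by rewrite hornerM; field.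
  by move=> h; rewrite pmulr_llt0 ?exprn_even_gt0.
rewrite -lead_coefM -sgr_lt0 -/(sgp_pinfty _).
have x1 : x < x + 1 by rewrite ltrDl.
rewrite -(@sgp_pinftyP _ (x + 1) (q * P) _ (x + 1)) ?in_itv /= ?lexx //.
  by rewrite sgr_lt0 qP_lt0.
move=> z; rewrite in_itv /= andbT => xz.
by rewrite rootE lt_eqF // qP_lt0 // (lt_le_trans x1).
Qed.

(** The mirror image of [gap_right]; the power of [-1] turns the sign of the
    leading coefficient of [q P] into its sign near minus infinity. *)
Lemma gap_left x : root q x -> ~~ root P x ->
  (forall y, y < x -> ~~ root P y && ~~ root W y) ->
  0 < (-1) ^+ (size (q * P)).-1 * (lead_coef q * lead_coef P).
Proof.
move=> /rootP qx Px no.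
have nP z : z <= x -> ~~ root P z.
  by rewrite le_eqVlt => /predU1P[->//|/no/andP[]].
have qP_gt0 y : y < x -> 0 < (q * P).[y].
  move=> xy; have Py : P.[y] != 0 by apply/nP/ltW.
  have := @dshift_decr y x xy; rewrite qx mul0r => /(_ _ _)/wrap[].
  - by move=> z /andP[_ /nP].
  - move=> z /andP[_ xz]; apply: (logwronsk_lt0_left (x := x)) => // t /no.
    by case/andP.
  have -> : (q * P).[y] = q.[y] / P.[y] * P.[y] ^+ 2 by rewrite hornerM; field.
  by move=> h; rewrite pmulr_lgt0 ?exprn_even_gt0.
rewrite -lead_coefM -sgr_gt0 -/(sgp_minfty _).
have x1 : x - 1 < x by rewrite gtrDl oppr_lt0.
rewrite -(@sgp_minftyP _ (x - 1) (q * P) _ (x - 1)) ?in_itv /= ?lexx //.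
  by rewrite sgr_gt0 qP_gt0.
move=> z; rewrite in_itv /= => xz.
by rewrite rootE gt_eqF // qP_gt0 // (le_lt_trans xz).
Qed.

End Gaps.

(** * Counting distinct zeros *)

Lemma path_le_last d (T : orderType d) (x y : T) t :
  path <%O x t -> y \in x :: t -> (y <= last x t)%O.
Proof.
elim: t x y => [|z t IH] x y /=; first by rewrite inE => _ /eqP->.
case/andP=> xz zt; rewrite inE => /predU1P[->|]; last exact: IH.
exact: le_trans (ltW xz) (IH z z zt (mem_head _ _)).
Qed.

(** Points of [Y] separating the consecutive points of a strictly increasing
    list are at least as many as its gaps. *)
Lemma gaps_count d (T : orderType d) (X Y : seq T) x : path <%O x X ->
  (forall a b, a \in x :: X -> b \in x :: X -> (a < b)%O ->
     (forall c, c \in x :: X -> ~~ (a < c < b)%O) ->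
     exists2 y, y \in Y & (a < y < b)%O) ->
  (size X <= count (fun y => (x < y < last x X)%O) Y)%N.
Proof.
elim: X x => [|z X IH] x //= /andP[xz zX] gap.
have zX' c : c \in z :: X -> (z <= c)%O.
  rewrite inE => /predU1P[->//|cX]; apply/ltW.
  by move/allP: (order_path_min lt_trans zX); apply.
have zlast : (z <= last z X)%O by apply/zX'/mem_last.
have h1 : (size X <= count (fun y => (z < y < last z X)%O) Y)%N.
  apply: IH zX _ => a b az bz ab nc; apply: gap => //.
  - by rewrite inE az orbT.
  - by rewrite inE bz orbT.
  move=> c; rewrite inE => /predU1P[->|]; last exact: nc.
  by rewrite ltNge (ltW (lt_le_trans xz (zX' a az))).
have h2 : (0 < count (fun y => (x < y < z)%O) Y)%N.
  have [||||y yY yxz] := gap x z; rewrite ?inE ?eqxx ?orbT //.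
    move=> c; rewrite inE => /predU1P[->|/zX' zc]; first by rewrite ltxx.
    by rewrite negb_and -!leNgt zc orbT.
  by rewrite -has_count; apply/hasP; exists y.
rewrite -add1n; apply: leq_trans (leq_add h2 h1) _.
rewrite -count_predUI.
rewrite [X in (_ + X <= _)%N](eq_count (a2 := pred0)) ?count_pred0 ?addn0.
  apply: sub_count => y /= /orP[/andP[-> yz]|/andP[zy ->]].
    exact: lt_le_trans yz zlast.
  by rewrite (lt_trans xz zy).
move=> y /=; apply/negP => /andP[/andP[_ yz] /andP[zy _]].
by move: (lt_trans yz zy); rewrite ltxx.
Qed.

Lemma mem_rootsR (R : rcfType) (f : {poly R}) x : f != 0 ->
  (x \in rootsR f) = root f x.
Proof. by move=> f0; rewrite -(roots_on_rootsR f0) in_itv. Qed.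

Lemma rootsR_uniq (R : rcfType) (f : {poly R}) : uniq (rootsR f).
Proof. exact/lt_sorted_uniq/sorted_roots. Qed.

(** One of two polynomials of consecutive degrees has odd degree, hence a real
    root. *)
Lemma root_or_deriv_root (R : rcfType) (f : {poly R}) : (1 < size f)%N ->
  (exists x, root f x) \/ (exists x, root f^`() x).
Proof.
move=> f1; apply: contrapT => /not_orP[/forallNP nf /forallNP ndf].
have lcf : lead_coef f != 0.
  by rewrite lead_coef_eq0 -size_poly_eq0; case: (size f) f1.
have eqsg (g : {poly R}) :
    (forall x, ~ root g x) -> sgp_pinfty g = sgp_minfty g.
  move=> ng; rewrite -(@sgp_pinftyP _ 0 g _ 0) ?in_itv /= ?lexx //.
    by rewrite (@sgp_minftyP _ 0 g _ 0) ?in_itv /= ?lexx // => x _; apply/negP.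
  by move=> x _; apply/negP.
have := eqsg _ nf; have := eqsg _ ndf.
rewrite /sgp_pinfty /sgp_minfty !sgrM !sgrX !sgrN sgr1 size_deriv.
have : Num.sg (lead_coef f^`()) = Num.sg (lead_coef f).
  rewrite lead_coef_deriv // -mulr_natr sgrM sgr_nat.
  by case: (size f) f1 => [|[|n]] // _; rewrite mulr1.
move=> ->; set c := Num.sg _; have c0 : c != 0 by rewrite sgr_eq0.
move=> h1 h2.
have /(mulIf c0) : 1 * c = (-1) ^+ (size f).-2 * c by rewrite mul1r.
have /(mulIf c0) : 1 * c = (-1) ^+ (size f).-1 * c by rewrite mul1r.
case: (size f) f1 => [|[|n]] //= _; rewrite exprS => B A; move: B.
by rewrite -A; lra.
Qed.

Section Count.
Variables (R : realType) (P : {poly R}) (s : R).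
Hypothesis P1 : (1 < size P)%N.
Let q := dshift P s.
Let W := logwronsk P.
Let P0 : P != 0. Proof. by rewrite -size_poly_eq0; case: (size P) P1. Qed.
Let q0 : q != 0. Proof. exact: dshift_neq0. Qed.
Let W0 : W != 0. Proof. exact: logwronsk_neq0. Qed.

Let X := [seq x <- rootsR q | ~~ root P x].
Let Y := rootsR P ++ [seq y <- rootsR W | ~~ root P y & ~~ root q y].

(** [X] lists the zeros of [q] off those of [P], and [Y] those of [P] followed
    by those of [W] off [P q].  If [X] is empty, the only claim is for [s = 0],
    where [q = P'] and [root_or_deriv_root] applies. *)
Lemma count_gaps : (size X + (s == 0%R) <= size Y)%N.
Proof.
have memX x : (x \in X) = ~~ root P x && root q x.
  by rewrite mem_filter mem_rootsR.
have YP y : root P y -> y \in Y by move=> Py; rewrite mem_cat mem_rootsR ?Py.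
have YW y : root W y -> y \notin X -> y \in Y.
  rewrite memX mem_cat mem_filter !mem_rootsR // => ->; rewrite andbT.
  by case: (root P y).
have sX : sorted <%O X.
  by apply: sorted_filter; [exact: lt_trans|exact: sorted_roots].
case EX : X => [|x X'].
  rewrite add0n; case: eqP => //= sE.
  suff [y] : exists y, y \in Y by case: Y.
  have [[y Py]|[y dPy]] := root_or_deriv_root P1; first by exists y; apply: YP.
  have : y \notin X by rewrite EX.
  rewrite memX negb_and negbK /q /dshift sE scale0r addr0 dPy orbF => Py.
  by exists y; apply: YP.
have {}sX : path <%O x X' by move: sX; rewrite EX.
set l := last x X'.
have lX : l \in X by rewrite EX mem_last.
have Xge y : y \in X -> x <= y.
  rewrite EX inE => /predU1P[->//|yX].
  by have /allP/(_ y yX)/ltW := order_path_min lt_trans sX.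
have Xle y : y \in X -> y <= l. by rewrite EX; apply: path_le_last.
have xX : x \in X by rewrite EX mem_head.
have [nPx qx] : ~~ root P x /\ root q x by move: xX; rewrite memX => /andP.
have [nPl ql] : ~~ root P l /\ root q l by move: lX; rewrite memX => /andP.
have inner : (size X' <= count (fun y => (x < y < l)%R) Y)%N.
  apply: gaps_count sX _; rewrite -EX => a b; rewrite !memX.
  move=> /andP[nPa qa] /andP[nPb qb] ab nX.
  have [[y [yab Py]]|/forallNP noP] :=
    pselect (exists y, a < y < b /\ root P y).
    by exists y => //; apply: YP.
  have [z|y yab Wy] := @rolle_dshift _ P s a b ab qa qb.
    move=> /andP[]; rewrite !le_eqVlt => /predU1P[<-//|az] /predU1P[->//|zb].
    by apply/negP => Pz; apply: (noP z); rewrite az zb.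
  by exists y => //; apply: YW => //; apply/negP => /nX; rewrite yab.
have right : has (fun y => l < y) Y \/ lead_coef q * lead_coef P < 0.
  case: (boolP (has _ _)) => [|/hasPn noY]; [by left|right].
  apply: (gap_right P1 ql nPl) => y ly; apply/andP; split.
    by apply/negP => /YP/noY; rewrite ly.
  apply/negP => Wy; have := noY y (YW y Wy _); rewrite ly => /(_ _)/negP.
  apply=> //.
  by apply/negP => /Xle; rewrite leNgt ly.
have left : has (fun y => y < x) Y \/
    0 < (-1) ^+ (size (q * P)).-1 * (lead_coef q * lead_coef P).
  case: (boolP (has _ _)) => [|/hasPn noY]; [by left|right].
  apply: (gap_left P1 qx nPx) => y ly; apply/andP; split.
    by apply/negP => /YP/noY; rewrite ly.
  apply/negP => Wy; have := noY y (YW y Wy _); rewrite ly => /(_ _)/negP.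
  apply=> //.
  by apply/negP => /Xge; rewrite leNgt ly.
(* Half-lines on which Y has a point: at least one of the two, and both if
   s = 0.  The signs are those of q P = s P^2 + P' P, of degree 2n if s <> 0
   and 2n - 1 if s = 0. *)
have outer : ((s == 0%R).+1 <=
    has (fun y => (y < x)%R) Y + has (fun y => (l < y)%R) Y)%N.
  have lcP : 0 < lead_coef P ^+ 2 by rewrite exprn_even_gt0 //= lead_coef_eq0.
  move: left right; rewrite size_mul // lead_coef_dshift // size_dshift //.
  case: eqVneq => [sE|sE].
    rewrite mulrnAl -expr2 subn1.
    have -> : ((size P).-1 + size P).-2 = ((size P).-2.*2).+1.
      by case: (size P) P1 => [|[|n]] //= _; rewrite addnS -addnn addnS.
    rewrite exprS -[X in _ * X * _]signr_odd odd_double expr0 mulr1.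
    rewrite mulN1r oppr_gt0 -mulr_natr.
    case=> [->|]; last by rewrite pmulr_rlt0 // ltrn0.
    by case=> [->//|]; rewrite pmulr_rlt0 // ltrn0.
  rewrite subn0 addnn -mulrA -expr2 pmulr_llt0 //.
  have -> : (size P).*2.-2 = (size P).-1.*2 by case: (size P).
  rewrite -[X in X * _]signr_odd odd_double expr0 mul1r pmulr_lgt0 //.
  case=> [->//|s0] [->|]; first by case: has.
  by move=> /(lt_trans s0); rewrite ltxx.
have count3 : (count (fun y => (y < x)%R) Y + count (fun y => (x < y < l)%R) Y
    + count (fun y => (l < y)%R) Y <= size Y)%N.
  have xl : x <= l := Xge _ lX.
  elim: (Y) => //= y Y' IH.
  have : ((y < x)%R + (x < y < l)%R + (l < y)%R <= 1)%N.
    have [hx|hx] := ltP y x; have [hl|hl] := ltP l y.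
    - by move: (lt_trans hx (le_lt_trans xl hl)); rewrite ltxx.
    - by rewrite (lt_gtF hx).
    - by rewrite (lt_gtF hl) andbF.
    - by case: (_ && _).
  have arith a b c d e g n : (a + b + c <= 1 -> d + e + g <= n ->
    (a + d) + (b + e) + (c + g) <= n.+1)%N by clear; lia.
  by move=> /arith; apply.
have arith (a b c k n : nat) (d : bool) :
  (k <= b -> d.+1 <= (0 < a) + (0 < c) ->
   a + b + c <= n -> k.+1 + d <= n)%N by clear; case: d; lia.
by rewrite !has_count in outer; apply: arith inner outer count3.
Qed.
End Count.

(** * Counting zeros with multiplicity *)

Lemma sum_rootsR_swap (R : rcfType) (f g : {poly R}) (a : pred R)
    (h : R -> nat) :
  f != 0 -> g != 0 ->
  (\sum_(x <- rootsR f | root g x && a x) h x =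
   \sum_(x <- rootsR g | root f x && a x) h x)%N.
Proof.
move=> f0 g0; rewrite -big_filter -[RHS]big_filter; apply: perm_big.
apply: uniq_perm; rewrite ?filter_uniq ?rootsR_uniq // => x.
rewrite !mem_filter !mem_rootsR // andbAC [RHS]andbAC.
by rewrite [root g x && root f x]andbC.
Qed.

(** [count_gaps] with multiplicities. *)
Lemma sum_mup_dshift (R : realType) (P : {poly R}) s : (1 < size P)%N ->
  (\sum_(x <- rootsR (dshift P s)) mup x (dshift P s) + (s == 0%R) <=
   \sum_(x <- rootsR (logwronsk P) | ~~ root P x) mup x (logwronsk P) +
   \sum_(x <- rootsR P) mup x P)%N.
Proof.
move=> P1.
have P0 : P != 0 by rewrite -size_poly_eq0; case: (size P) P1.
have q0 := dshift_neq0 s P1; have W0 := logwronsk_neq0 P1.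
have gaps := count_gaps s P1.
set q := dshift P s in q0 gaps *; set W := logwronsk P in W0 gaps *.
have sqP : (\sum_(x <- rootsR q | root P x) mup x q + size (rootsR P) <=
    \sum_(x <- rootsR P) mup x P)%N.
  have -> : (\sum_(x <- rootsR q | root P x) mup x q =
      \sum_(x <- rootsR P | root q x) mup x q)%N.
    have := sum_rootsR_swap predT (fun x : R => mup x q) q0 P0.
    by under eq_bigl do rewrite andbT; under [RHS]eq_bigl do rewrite andbT.
  rewrite -sum1_size.
  apply: (@leq_trans (\sum_(x <- rootsR P) (mup x q + 1))%N).
    by rewrite big_split leq_add2r [leqRHS](bigID (root q)) leq_addr.
  rewrite big_seq [leqRHS]big_seq; apply: leq_sum => x.
  by rewrite mem_rootsR // addn1 => Px; apply: mup_dshift_root.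
have sX : (\sum_(x <- rootsR q | ~~ root P x) mup x q <=
    \sum_(x <- rootsR q | ~~ root P x) mup x W +
    size [seq x <- rootsR q | ~~ root P x])%N.
  rewrite size_filter -sum1_count -big_split /=; apply: leq_sum => x _.
  by rewrite addn1; apply: leq_trans (leqSpred _) _; rewrite ltnS mup_logwronsk.
have sWq : (\sum_(x <- rootsR q | ~~ root P x) mup x W =
    \sum_(x <- rootsR W | root q x && ~~ root P x) mup x W)%N.
  rewrite -(sum_rootsR_swap _ _ q0 W0) (bigID (root W)) /=.
  rewrite [X in (_ + X)%N]big1 ?addn0.
    by apply: eq_bigl => x; rewrite andbC.
  by move=> x /andP[_ Wx]; rewrite mupNroot.
have sW : (size [seq y <- rootsR W | ~~ root P y & ~~ root q y] <=
    \sum_(x <- rootsR W | ~~ root P x && ~~ root q x) mup x W)%N.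
  rewrite size_filter -sum1_count big_seq_cond [leqRHS]big_seq_cond.
  by apply: leq_sum => x /andP[]; rewrite mem_rootsR // mup_gt0.
rewrite (bigID (root P)) /= [X in (_ <= X + _)%N](bigID (root q)) /=.
under [X in (_ <= X + _ + _)%N]eq_bigl do rewrite andbC.
rewrite -sWq; move: gaps sqP sX sW; rewrite size_cat.
have arith (a b c d e r g n k : nat) : (a + k <= r + b -> c + r <= n ->
  d <= e + a -> b <= g -> c + d + k <= e + g + n)%N by clear; lia.
exact: arith.
Qed.

(** * Zeros of real polynomials in the complex plane *)

Section ComplexCounting.
Variable R : realType.
Local Notation toC := (real_complex R).
Implicit Types (f : {poly R}) (x : R).

Lemma esum_count_mem (T : choiceType) (rs : seq T) (A : {pred T}) :
  (\esum_(z in [set z | z \in A]) (count_mem z rs)%:R%:E =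
     (count (mem A) rs)%:R%:E :> \bar R)%E.
Proof.
elim: rs => [|x rs IH] /=; first by rewrite esum1.
under eq_esum do rewrite natrD EFinD.
rewrite esumD => [|z _|z _]; last 2 first.
- by rewrite lee_fin.
- by rewrite lee_fin.
rewrite IH natrD EFinD; congr (_ + _)%E.
transitivity (\esum_(z in [set z | z \in A])
    if z \in [set x]%classic then 1 else 0 : \bar R)%E.
  apply: eq_esum => z _.
  have -> : (z \in [set x]%classic) = (x == z).
    by apply/idP/idP; rewrite inE /= eq_sym => /eqP.
  by case: (x == z).
rewrite -esum_mkcondr; have [Ax|Ax] := boolP (x \in A).
  rewrite (_ : _ `&` _ = [set x])%classic ?esum_set1 ?lee_fin //.
  by apply/seteqP; split => z /= [] // ->.
rewrite (_ : _ `&` _ = set0)%classic ?esum_set0 //.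
by apply/seteqP; split => z //= [Az zx]; move: Ax; rewrite -zx Az.
Qed.

Lemma zmult_poly (p : {poly R[i]}) z : p != 0 -> zmult p%:F z = (mup z p)%:R%:E.
Proof.
move=> p0; have -> : p%:F = p%:F / 1%:F by rewrite tofrac1 divr1.
by rewrite zmultE ?oner_neq0 // (@mupNroot _ z 1) ?root1 // subn0.
Qed.

Lemma mup_map_real f x : f != 0 -> mup (toC x) (map_poly toC f) = mup x f.
Proof.
move=> f0; have F0 : map_poly toC f != 0 by rewrite map_poly_eq0.
have e n : (n <= mup (toC x) (map_poly toC f))%N = (n <= mup x f)%N.
  by rewrite !mup_geq // -map_polyXsubC -rmorphXn dvdp_map.
by apply/eqP; rewrite eqn_leq -e leqnn e leqnn.
Qed.

(** [L] may contain more than the real elements of [rs]. *)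
Lemma count_real_sum (rs : seq R[i]) (L : seq R) : uniq L ->
  (forall x, toC x \in rs -> x \in L) ->
  count (mem Num.real) rs = (\sum_(x <- L) count_mem (toC x) rs)%N.
Proof.
move=> uL; elim: rs => [|z rs IH] rsL /=; first by rewrite big1.
rewrite big_split IH => [|x xrs]; last by apply: rsL; rewrite inE xrs orbT.
congr (_ + _)%N; have [/complex_realP[x zx]|zr] := boolP (z \in Num.real).
  have xL : x \in L by apply: rsL; rewrite zx mem_head.
  transitivity (count_mem x L); first by rewrite count_uniq_mem // xL.
  rewrite -sum1_count big_mkcond /=; apply: eq_bigr => y _.
  by rewrite zx (inj_eq (@complexI R)) eq_sym; case: eqP.
rewrite big1 // => y _; case: eqP => // zy.
by move: zr; rewrite zy; move/complex_realP => []; exists y.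
Qed.

Lemma ZC_real_poly f : f != 0 -> exists2 k : nat,
  ZC (map_poly toC f)%:F = k%:R%:E &
  (k + \sum_(x <- rootsR f) mup x f = (size f).-1)%N.
Proof.
move=> f0; have F0 : map_poly toC f != 0 by rewrite map_poly_eq0.
have [rs Frs] := closed_field_poly_normal (map_poly toC f).
have mupE z : mup z (map_poly toC f) = count_mem z rs.
  rewrite Frs -mul_polyC mupMr ?mu_prod_XsubC //.
  by rewrite rootC lead_coef_eq0.
exists (count (mem [predC Num.real]) rs).
  rewrite /ZC -esum_count_mem; apply: eq_esum => z _.
  by rewrite zmult_poly // mupE.
have sz : (size f).-1 = size rs.
  have := congr1 (fun p : {poly _} => (size p).-1) Frs.
  by rewrite /= size_map_poly size_scale ?lead_coef_eq0 // size_prod_XsubC.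
have rootrs x : toC x \in rs -> x \in rootsR f.
  rewrite mem_rootsR // -mup_gt0 // -mup_map_real // mupE -has_count.
  by rewrite has_pred1.
rewrite sz -(count_predC (mem Num.real)) addnC; congr (_ + _)%N.
rewrite (count_real_sum (rootsR_uniq f) rootrs); apply: eq_bigr => x _.
by rewrite -mup_map_real // mupE.
Qed.

Lemma ZC0 : ZC (0%:F : {fraction {poly R[i]}}) = +oo%E.
Proof.
apply/eqP; rewrite -leye_eq; apply: esum_ge.
exists [set 'i%C]%classic; last by rewrite fsbig_set1 /zmult tofrac0 eqxx.
split; first exact: finite_set1.
by move=> z /= ->; rewrite complex_real oner_eq0.
Qed.

Lemma zmult_ge0 (g : {fraction {poly R[i]}}) z : (0 <= zmult g z)%E.
Proof. by rewrite /zmult; case: ifP => // _; rewrite lee_fin. Qed.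

Lemma map_dshift f s : psigma (map_poly toC f) s = map_poly toC (dshift f s).
Proof. by rewrite /psigma /dshift rmorphD /= map_polyZ deriv_map. Qed.

(** Equality holds, but only this inequality is needed: off the zeros of [f],
    the multiplicities of the zeros of [Q] are those of its numerator. *)
Lemma ZR_Q_ge f : (1 < size f)%N ->
  ((\sum_(x <- rootsR (logwronsk f) | ~~ root f x) mup x (logwronsk f))%:R%:E
    <= ZR (Q (map_poly toC f)))%E.
Proof.
move=> f1; have W0 := logwronsk_neq0 f1.
have f0 : f != 0 by rewrite -size_poly_eq0; case: (size f) f1.
have F0 : map_poly toC f != 0 by rewrite map_poly_eq0.
have FW0 : map_poly toC (logwronsk f) != 0 by rewrite map_poly_eq0.
have QW : Q (map_poly toC f) =
    (map_poly toC (logwronsk f))%:F / (map_poly toC f ^+ 2)%:F.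
  by rewrite QE // !deriv_map -rmorphXn -rmorphM -rmorphB.
rewrite -big_filter; set L := [seq x <- _ | _].
have uL : uniq L by rewrite filter_uniq // rootsR_uniq.
apply: esum_ge; exists [set` map toC L]%classic.
  split; first exact: finite_seq.
  by move=> z /= /mapP[x _ ->]; apply/complex_realP; exists x.
rewrite -fsbig_seq; last by rewrite map_inj_uniq //; exact: complexI.
rewrite big_map natr_sum -sumEFin big_seq [leRHS]big_seq; apply: lee_sum => x.
rewrite mem_filter => /andP[fx _].
rewrite QW zmultE ?expf_neq0 // [X in (_ - X)%N]mupNroot.
  by rewrite subn0 mup_map_real.
rewrite rootE horner_exp expf_eq0 /= -rootE.
by rewrite (fmorph_root toC).
Qed.

End ComplexCounting.

Lemma real_polyP (R : realType) (p : {poly R[i]}) :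
  real_poly p -> exists f : {poly R}, p = map_poly (real_complex R) f.
Proof.
move=> /polyOverP pr; exists (\poly_(i < size p) complex.Re p`_i).
apply/polyP => i; rewrite coef_map coef_poly; case: ltnP => [_|pi] /=.
  by rewrite RRe_real.
by rewrite nth_default.
Qed.

Theorem theorem4p6 (R : realType) (p : {poly R[i]}) (m msigma : nat) :
  real_poly p ->
  ZC p%:F = ((2 * m)%:R)%:E ->
  is_min [set ZC (psigma p sigma)%:F | sigma in [set: R]]
    ((2 * msigma)%:R)%:E ->
  (((2 * m)%:R)%:E - ((2 * msigma)%:R)%:E <= ZR (Q p))%E.
Proof.
move=> /real_polyP[f ->] Zp [[s _ Zq] _].
have f0 : f != 0.
  by apply/eqP => fE; move: Zp; rewrite fE rmorph0 ZC0.
have [k Zk kE] := ZC_real_poly f0.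
have {Zk Zp} km : (2 * m)%N = k.
  by move: Zp; rewrite Zk => -[] /eqP; rewrite eqr_nat => /eqP.
rewrite -EFinB.
have [f1|f1] := ltnP 1 (size f); last first.
  (* A nonzero constant has no zeros, so m = 0. *)
  apply: le_trans (_ : 0 <= _)%E; last first.
    by apply: esum_ge0 => z _; apply: zmult_ge0.
  rewrite lee_fin subr_le0 ler_nat km (leq_trans _ (leq0n _)) //.
  rewrite -(leq_add2r (\sum_(x <- rootsR f) mup x f)) kE.
  by case: (size f) f1 => [|[]].
apply: le_trans (ZR_Q_ge f1); rewrite lee_fin lerBlDr -natrD ler_nat.
have [l Zl lE] := ZC_real_poly (dshift_neq0 s f1).
have {Zl Zq} lm : (2 * msigma)%N = l.
  by move: Zq; rewrite map_dshift Zl => -[] /eqP; rewrite eqr_nat => /eqP.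
have arith (a b c d e g n : nat) : (1 < n -> b + c = (n - e).-1 ->
  a + d = n.-1 -> c + e <= g + d -> a <= g + b)%N by clear; lia.
rewrite size_dshift // in lE; rewrite km lm.
exact: arith f1 lE kE (sum_mup_dshift s f1).
Qed.
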